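(* Let $\mathfrak{h}_1$ be the three-dimensional Heisenberg Lie algebra. The tangent Lie algebra $T\mathfrak{h}_1$ carries several (that is, more than one) Kähler structures. However, no abelian complex structure $J$ on $T\mathfrak{h}_1$ admits a symplectic structure $\omega$ on $T\mathfrak{h}_1$ such that $(J,\omega)$ is a Kähler structure.
   Context: $T\mathfrak{h}_1$ is the six-dimensional real Lie algebra with basis $e_1,\dots,e_6$ and non-zero brackets $[e_1,e_2]=e_3$, $[e_1,e_5]=e_6$, $[e_2,e_4]=-e_6$. A complex structure on a real Lie algebra $\mathfrak{g}$ is a linear map $J$ with $J^2=-\mathrm{I}$ and $[Jx,Jy]-[x,y]-J[Jx,y]-J[x,Jy]=0$ for all $x,y\in\mathfrak{g}$; it is abelian if $[Jx,Jy]=[x,y]$ for all $x,y$. A symplectic structure is a non-degenerate 2-form $\omega$ with $\omega([x,y],z)+\omega([y,z],x)+\omega([z,x],y)=0$. A Kähler structure (Kähler pair) on $\mathfrak{g}$ is a pair $(J,\omega)$ of a complex structure and a symplectic structure with $\omega(Jx,Jy)=\omega(x,y)$ for all $x,y$ (no positivity is required). *)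

(* Defs.v *)
From HB Require Import structures.
From mathcomp Require Import all_boot all_order all_algebra.
From mathcomp Require Import ring.

Set Implicit Arguments.
Unset Strict Implicit.
Unset Printing Implicit Defensive.

Import GRing.Theory.
Local Open Scope ring_scope.

HB.mixin Record isLieAlgebra (R : fieldType) V of Vector R V := {
  lie : V -> V -> V ;
  lie_bilinear : bilinear_for *:%R *:%R lie ;
  liexx : forall x, lie x x = 0 ;
  lie_jacobi : forall x y z,
    lie x (lie y z) + lie y (lie z x) + lie z (lie x y) = 0
}.

#[short(type="lieAlgType")]
HB.structure Definition LieAlgebra (R : fieldType) :=
  {V of Vector R V & isLieAlgebra R V}.

Definition complex_structure (R : fieldType) (g : lieAlgType R)
    (J : {linear g -> g}) : Prop :=
  (forall x, J (J x) = - x) /\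
  (forall x y,
     lie (J x) (J y) - lie x y - J (lie (J x) y) - J (lie x (J y)) = 0).

Definition abelian_complex_structure (R : fieldType) (g : lieAlgType R)
    (J : {linear g -> g}) : Prop :=
  complex_structure J /\ forall x y, lie (J x) (J y) = lie x y.

(* In characteristic 0, a 2-form is the same as a skew-symmetric bilinear
   form. *)
Definition symplectic_structure (R : fieldType) (g : lieAlgType R)
    (w : {skew_symmetric g}) : Prop :=
  nondegenerate w /\
  (forall x y z, w (lie x y) z + w (lie y z) x + w (lie z x) y = 0).

Definition kahler_structure (R : fieldType) (g : lieAlgType R)
    (J : {linear g -> g}) (w : {skew_symmetric g}) : Prop :=
  [/\ complex_structure J, symplectic_structure w &
      forall x y, w (J x) (J y) = w x y].

(* [bvec R n i] is e_i in dimension n.+1, and [pl x y i j] is the coordinate of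
   the bivector of x and y on that of e_i and e_j, with indices
   starting from 1 as in the usual notation for bases. *)
Definition bvec (R : fieldType) n (i : nat) : 'rV[R]_n.+1 :=
  delta_mx 0 (inord i.-1).
Definition pl (R : fieldType) n (x y : 'rV[R]_n.+1) (i j : nat) : R :=
  x 0 (inord i.-1) * y 0 (inord j.-1) - x 0 (inord j.-1) * y 0 (inord i.-1).

(* [e_1, e_2] = e_3 *)
Definition heis (R : fieldType) : Type := 'rV[R]_3.
HB.instance Definition _ (R : fieldType) := Vector.on (heis R).
Definition heis_lie (R : fieldType) (x y : heis R) : heis R :=
  pl x y 1 2 *: bvec R 2 3.

(* [e_1, e_2] = e_3, [e_1, e_5] = e_6, [e_2, e_4] = - e_6 *)
Definition Th1 (R : fieldType) : Type := 'rV[R]_6.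
HB.instance Definition _ (R : fieldType) := Vector.on (Th1 R).
Definition Th1_lie (R : fieldType) (x y : Th1 R) : Th1 R :=
  pl x y 1 2 *: bvec R 5 3 + (pl x y 1 5 - pl x y 2 4) *: bvec R 5 6.

Lemma bvecE (R : fieldType) n i j : (0 < i <= n.+1)%N -> (0 < j <= n.+1)%N ->
  bvec R n i 0 (inord j.-1) = (i == j)%:R.
Proof.
case: i j => // i [] // j /= lti ltj.
by rewrite mxE eqxx /= -val_eqE /= !inordK // eqSS eq_sym.
Qed.

Lemma Th1_lie_bilinear (R : fieldType) :
  bilinear_for *:%R *:%R (@Th1_lie R).
Proof.
split=> u a v w; apply/rowP => k; rewrite /Th1_lie /pl !mxE;
  by move: (_ && _)%:R (_ && _)%:R => c d; ring.
Qed.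

Lemma Th1_liexx (R : fieldType) (x : Th1 R) : Th1_lie x x = 0.
Proof.
apply/rowP => k; rewrite /Th1_lie /pl !mxE;
  by move: (_ && _)%:R (_ && _)%:R => c d; ring.
Qed.

Lemma Th1_lie_jacobi (R : fieldType) (x y z : Th1 R) :
  Th1_lie x (Th1_lie y z) + Th1_lie y (Th1_lie z x) +
  Th1_lie z (Th1_lie x y) = 0.
Proof.
have c0 i (u v : Th1 R) : i \in [:: 1; 2; 4; 5]%N ->
    (Th1_lie u v) 0 (inord i.-1) = 0.
  have -> : Th1_lie u v 0 (inord i.-1) =
      pl u v 1 2 * bvec R 5 3 0 (inord i.-1) +
      (pl u v 1 5 - pl u v 2 4) * bvec R 5 6 0 (inord i.-1) by rewrite !mxE.
  by rewrite !inE => /or4P[] /eqP->; rewrite !bvecE //= !mulr0 addr0.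
have l0 (t u v : Th1 R) : Th1_lie t (Th1_lie u v) = 0.
  rewrite {1}/Th1_lie /pl !c0 // !mulr0 !subr0.
  by rewrite !scale0r addr0.
by rewrite !l0 !addr0.
Qed.

HB.instance Definition _ (R : fieldType) := isLieAlgebra.Build R (Th1 R)
  (@Th1_lie_bilinear R) (@Th1_liexx R) (@Th1_lie_jacobi R).

Lemma heis_lie_bilinear (R : fieldType) :
  bilinear_for *:%R *:%R (@heis_lie R).
Proof.
split=> u a v w; apply/rowP => k; rewrite /heis_lie /pl !mxE;
  by move: (_ && _)%:R => c; ring.
Qed.

Lemma heis_liexx (R : fieldType) (x : heis R) : heis_lie x x = 0.
Proof.
apply/rowP => k; rewrite /heis_lie /pl !mxE;
  by move: (_ && _)%:R => c; ring.
Qed.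

Lemma heis_lie_jacobi (R : fieldType) (x y z : heis R) :
  heis_lie x (heis_lie y z) + heis_lie y (heis_lie z x) +
  heis_lie z (heis_lie x y) = 0.
Proof.
have c0 i (u v : heis R) : i \in [:: 1; 2]%N ->
    (heis_lie u v) 0 (inord i.-1) = 0.
  by rewrite /heis_lie mxE !inE => /orP[] /eqP->; rewrite bvecE //= mulr0.
have l0 (t u v : heis R) : heis_lie t (heis_lie u v) = 0.
  by rewrite {1}/heis_lie /pl !c0 // !mulr0 subr0 scale0r.
by rewrite !l0 !addr0.
Qed.

HB.instance Definition _ (R : fieldType) := isLieAlgebra.Build R (heis R)
  (@heis_lie_bilinear R) (@heis_liexx R) (@heis_lie_jacobi R).

(* Semidirect product of g with the abelian Lie algebra g, through ad. *)
Definition tangent_lie (R : fieldType) (g : lieAlgType R) (u v : g * g) :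
    g * g :=
  (lie u.1 v.1, lie u.1 v.2 - lie v.1 u.2).

Lemma Th1_tangent (R : fieldType) :
  exists f : {linear Th1 R -> (heis R * heis R)%type},
    bijective f /\ forall x y, f (lie x y) = tangent_lie (f x) (f y).
Proof.
pose f (x : Th1 R) : (heis R * heis R)%type :=
  (lsubmx (x : 'rV_(3 + 3)), rsubmx (x : 'rV_(3 + 3))).
have fL : linear f.
  by move=> a u v; congr pair; apply/rowP => k; rewrite !mxE.
pose fl : {linear Th1 R -> (heis R * heis R)%type} :=
  HB.pack f (GRing.isLinear.Build _ _ _ _ f fL).
exists fl; split.
  exists (fun u => row_mx (u.1 : 'rV_3) (u.2 : 'rV_3)) => [x|[u v]].
    exact: (@hsubmxK _ 1 3 3 x).
  by rewrite /= /f row_mxKl row_mxKr.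
have lsE (x : Th1 R) i : (0 < i <= 3)%N ->
    (lsubmx (x : 'rV_(3 + 3)) : 'rV_3) 0 (inord i.-1) = x 0 (inord i.-1).
  case: i => // i /= lti; rewrite mxE; congr (x _ _).
  by apply/val_inj; rewrite /= !inordK // (leq_trans lti).
have rsE (x : Th1 R) i : (0 < i <= 3)%N ->
    (rsubmx (x : 'rV_(3 + 3)) : 'rV_3) 0 (inord i.-1) = x 0 (inord (i + 3).-1).
  case: i => // i /= lti; rewrite mxE; congr (x _ _).
  by apply/val_inj; rewrite /= !inordK // addnC ?addSn // ltn_add2l.
move=> x y; rewrite /= /f /tangent_lie /= /lie /=.
have b36 : lsubmx (bvec R 5 3 : 'rV_(3 + 3)) = bvec R 2 3.
  apply/rowP => k; rewrite !mxE; congr ((_ && _)%:R).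
  by rewrite -!val_eqE /= !inordK.
have b66 : lsubmx (bvec R 5 6 : 'rV_(3 + 3)) = 0.
  apply/rowP => k; rewrite !mxE -!val_eqE /= !inordK //.
  by rewrite ltn_eqF // (leq_trans (ltn_ord k)).
have c36 : rsubmx (bvec R 5 3 : 'rV_(3 + 3)) = 0.
  apply/rowP => k; rewrite !mxE -!val_eqE /= !inordK //.
have c66 : rsubmx (bvec R 5 6 : 'rV_(3 + 3)) = bvec R 2 3.
  apply/rowP => k; rewrite !mxE; congr ((_ && _)%:R).
  by rewrite -!val_eqE /= !inordK.
congr pair.
  rewrite /Th1_lie /heis_lie.
  rewrite (_ : lsubmx _ = pl x y 1 2 *: lsubmx (bvec R 5 3 : 'rV_(3 + 3)) +
    (pl x y 1 5 - pl x y 2 4) *: lsubmx (bvec R 5 6 : 'rV_(3 + 3)));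
    last by apply/rowP => k; rewrite !mxE.
  by rewrite b36 b66 scaler0 addr0 /pl !lsE.
rewrite /Th1_lie /heis_lie.
rewrite (_ : rsubmx _ = pl x y 1 2 *: rsubmx (bvec R 5 3 : 'rV_(3 + 3)) +
  (pl x y 1 5 - pl x y 2 4) *: rsubmx (bvec R 5 6 : 'rV_(3 + 3)));
  last by apply/rowP => k; rewrite !mxE.
rewrite c36 c66 scaler0 add0r /pl !lsE // !rsE // -scalerBl; congr (_ *: _).
by rewrite !addnE /=; ring.
Qed.

(* Main.v *)
Require Import Defs.
From HB Require Import structures.
From mathcomp Require Import all_boot all_order all_algebra.
From mathcomp Require Import reals.
From mathcomp Require Import ring.

(**
For the existence part, the complex structure e_1 -> e_4, e_2 -> - 2 e_5,
e_6 -> e_3 is compatible with each of the symplectic forms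
e^16 - e^34 + s e^25, where s <> 0.

For the second part, suppose that J is abelian.  Then J preserves the centre
<e_3, e_6>, and it also preserves W = <e_3, e_4, e_5, e_6>, which modulo the
centre is the kernel of the e_3-component of the bracket.  If w is closed, then
e_6 is w-orthogonal to W; if w is moreover compatible with J, then J e_6 is
orthogonal to J W = W.  As J e_6 is in the centre and J has no real eigenvalue,
e_3 is orthogonal to W as well.  But closedness identifies w(e_6, e_1) with
w(e_3, e_4) and w(e_6, e_2) with w(e_3, e_5), so e_6 is in the radical of w.
*)

Set Implicit Arguments.
Unset Strict Implicit.
Unset Printing Implicit Defensive.

Import GRing.Theory Num.Theory.
Local Open Scope ring_scope.

(** [nondegenerate] is phrased through the radical [orthov w fullv]; this form lets w be tested on
    individual vectors. *)
Lemma nondegenerateP (F : fieldType) (V : vectType F)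
    (w : {skew_symmetric V}) :
  reflect (forall u, (forall v, w u v = 0) -> u = 0) (nondegenerate w).
Proof.
have radP u : reflect (forall v, w u v = 0) (u \in orthov w fullv).
  apply: (iffP mem_orthovP) => [h v|h v _]; last exact: h.
  by apply: h; rewrite memvf.
apply: (iffP eqP) => [rad0 u /radP|rad0].
  by rewrite rad0 memv0 => /eqP.
apply/eqP; rewrite -subv0; apply/subvP => u /radP/rad0->.
exact: mem0v.
Qed.

(** * Coordinates on [Th1 F] *)

Section Coordinates.
Variable F : fieldType.
Implicit Types x y : Th1 F.

(** Indices start at 1; those out of range fall back to the first entry, whence the bounds in
    [coo_mk6] and [coo_e]. *)
Definition coo x (i : nat) : F := x 0 (inord i.-1).

Definition mk6 (s : seq F) : Th1 F := \row_(i < 6) s`_i.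

Definition e (i : nat) : Th1 F := bvec F 5 i.

Lemma coo_mk6 s i : (0 < i <= 6)%N -> coo (mk6 s) i = s`_i.-1.
Proof. by case: i => // i /= lti; rewrite /coo mxE inordK. Qed.

Lemma coo_e i j : (0 < i <= 6)%N -> (0 < j <= 6)%N ->
  coo (e i) j = (i == j)%:R.
Proof. exact: bvecE. Qed.

Lemma cooD x y i : coo (x + y) i = coo x i + coo y i.
Proof. exact: mxE. Qed.

Lemma cooN x i : coo (- x) i = - coo x i.
Proof. exact: mxE. Qed.

Lemma cooZ (a : F) x i : coo (a *: x) i = a * coo x i.
Proof. exact: mxE. Qed.

Lemma coo0 i : coo 0 i = 0.
Proof. exact: mxE. Qed.

Definition cooE := (cooD, cooN, cooZ, coo0).

Lemma plE x y i j : pl x y i j = coo x i * coo y j - coo x j * coo y i.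
Proof. by []. Qed.

Lemma lieE x y :
  lie x y = pl x y 1 2 *: e 3 + (pl x y 1 5 - pl x y 2 4) *: e 6.
Proof. by []. Qed.

Lemma coo_lie x y i : (0 < i <= 6)%N -> coo (lie x y) i =
  (coo x 1 * coo y 2 - coo x 2 * coo y 1) * (3 == i)%:R +
  (coo x 1 * coo y 5 - coo x 5 * coo y 1 -
    (coo x 2 * coo y 4 - coo x 4 * coo y 2)) * (6 == i)%:R.
Proof. by move=> ?; rewrite lieE cooD !cooZ !coo_e. Qed.

Lemma coo_inj x y : (forall i, (0 < i <= 6)%N -> coo x i = coo y i) -> x = y.
Proof.
move=> h; apply/rowP => i; have := h i.+1 (ltn_ord i).
by rewrite /coo /= inord_val.
Qed.

Lemma coo_inj6 x y :
  [/\ coo x 1 = coo y 1, coo x 2 = coo y 2 & coo x 3 = coo y 3] ->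
  [/\ coo x 4 = coo y 4, coo x 5 = coo y 5 & coo x 6 = coo y 6] -> x = y.
Proof.
by move=> [? ? ?] [? ? ?]; apply: coo_inj; do 7?[case=> [//|]].
Qed.

End Coordinates.

Local Ltac by_coo :=
  by apply: coo_inj6; split; rewrite !(cooE, coo_lie, coo_e) //=; ring.

(** * A one-parameter family of Kähler structures *)

Section Existence.
Variable F : fieldType.
Hypothesis two_neq0 : (2 : F) != 0.
Implicit Types x y : Th1 F.

(** The factor - 2 is forced: with e_2 -> c e_5, integrability on e_1, e_2 reads - e_3 - e_3 - c e_3
    = 0. *)
Definition Jex x : Th1 F :=
  mk6 [:: - coo x 4; coo x 5 / 2; coo x 6; coo x 1; - 2 * coo x 2; - coo x 3].

Lemma coo_Jex x i : (0 < i <= 6)%N -> coo (Jex x) i =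
  [:: - coo x 4; coo x 5 / 2; coo x 6; coo x 1; - 2 * coo x 2; - coo x 3]`_i.-1.
Proof. exact: coo_mk6. Qed.

Lemma Jex_linear : linear Jex.
Proof.
by move=> a x y; apply: coo_inj6; split; rewrite !cooE !coo_Jex //= !cooE; ring.
Qed.

HB.instance Definition _ :=
  GRing.isLinear.Build F (Th1 F) (Th1 F) *:%R Jex Jex_linear.

Lemma Jex_complex : complex_structure (Jex : {linear Th1 F -> Th1 F}).
Proof.
split=> [x|x y].
  by apply: coo_inj6; split; rewrite /= !(cooN, coo_Jex) //=; field.
by apply: coo_inj6; split;
  rewrite /= 3!cooD 3!cooN coo0 ![coo (Jex (lie _ _)) _]coo_Jex //= !coo_lie //=;
  rewrite !coo_Jex //=; field.
Qed.

(** The forms e^16 and e^34 have the same differential, and e^25 is closed. [Jex] swaps e^16 with -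
    e^34 and fixes e^25. *)
Definition wex (s : F) x y : F := pl x y 1 6 - pl x y 3 4 + s * pl x y 2 5.

Lemma wex_bilinear s : bilinear_for *%R (idfun \; *%R) (wex s).
Proof. by split=> u a x y; rewrite /wex !plE !cooE /=; ring. Qed.

Lemma wex_skew s x y : wex s x y = (-1) ^+ true * idfun (wex s y x).
Proof. by rewrite /wex !plE /=; ring. Qed.

HB.instance Definition _ s := bilinear_isBilinear.Build F (Th1 F) (Th1 F) F
  *%R (idfun \; *%R) (wex s) (wex_bilinear s).
HB.instance Definition _ s := isHermitianSesquilinear.Build F (Th1 F) true idfun
  (wex s) (wex_skew s).

Lemma wex_symplectic s : s != 0 ->
  symplectic_structure (wex s : {skew_symmetric (Th1 F)}).
Proof.
move=> s0; split=> [|x y z]; last first.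
  by rewrite /= /wex !plE !(cooE, coo_lie, coo_e) //=; ring.
apply/nondegenerateP => u hu.
(* Each basis vector pairs with exactly one other (1 with 6, 3 with 4, 2 with 5), so testing on e_i
   isolates one coordinate of u. *)
have h i := hu (e F i).
have s2 : coo u 2 = 0.
  apply: (mulfI s0); rewrite mulr0 -(h 5) /= /wex !plE !coo_e //=; ring.
have s5 : coo u 5 = 0.
  apply: (mulfI s0); apply: oppr_inj.
  by rewrite mulr0 oppr0 -(h 2) /= /wex !plE !coo_e //=; ring.
apply: coo_inj6; split; rewrite coo0 //.
- by rewrite -(h 6) /= /wex !plE !coo_e //=; ring.
- by apply: oppr_inj; rewrite oppr0 -(h 4) /= /wex !plE !coo_e //=; ring.
- by rewrite -(h 3) /= /wex !plE !coo_e //=; ring.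
- by apply: oppr_inj; rewrite oppr0 -(h 1) /= /wex !plE !coo_e //=; ring.
Qed.

Lemma Jex_wex_kahler s : s != 0 ->
  kahler_structure (Jex : {linear Th1 F -> Th1 F})
    (wex s : {skew_symmetric (Th1 F)}).
Proof.
move=> s0; split; [exact: Jex_complex | exact: wex_symplectic |].
by move=> x y; rewrite /= /wex !plE !coo_Jex //=; field.
Qed.

End Existence.

(** * Abelian complex structures over a field where -1 is not a square *)

Section Abelian.
Variable F : fieldType.
Hypothesis sqr_neqN1 : forall b : F, b * b != -1.

Definition inW (x : Th1 F) := coo x 1 = 0 /\ coo x 2 = 0.

Section AbelianComplexStructure.
Variable J : {linear Th1 F -> Th1 F}.
Hypothesis abJ : abelian_complex_structure J.

Let JK x : J (J x) = - x. Proof. by case: abJ => -[]. Qed.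

Lemma abelian_lieJl x y : lie (J x) y = - lie x (J y).
Proof.
case: abJ => _ /(_ x (J y)); rewrite JK => <-.
by_coo.
Qed.

(** Moving J across the bracket, the e_3-component of [J x, y] is minus that of [x, J y], which
    involves only coordinates 1 and 2 of x. *)
Lemma abelian_inW x : inW x -> inW (J x).
Proof.
move=> [x1 x2].
have h y : coo (lie (J x) y) 3 = 0.
  by rewrite abelian_lieJl !(cooE, coo_lie, coo_e) //= x1 x2; ring.
split; [move: (h (e F 2)) | move: (h (e F 1))];
  rewrite !(cooE, coo_lie, coo_e) //= !(mulr0, mulr1, addr0, subr0) //.
by rewrite sub0r => /eqP; rewrite oppr_eq0 => /eqP.
Qed.

Lemma abelian_Je6 : exists2 a, a != 0 &
  exists b, J (e F 6) = a *: e F 3 + b *: e F 6.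
Proof.
have [J1 J2] : inW (J (e F 6)) by apply: abelian_inW; split; rewrite coo_e.
(* J e_6 is central because e_6 is; bracketing with e_2 and e_1 then kills its coordinates 4 and
   5. *)
have h y : lie (J (e F 6)) y = 0.
  rewrite abelian_lieJl; apply: coo_inj6; split;
    by rewrite !(cooE, coo_lie, coo_e) //=; ring.
have J4 : coo (J (e F 6)) 4 = 0.
  have := congr1 (fun x => coo x 6) (h (e F 2)).
  by rewrite !(cooE, coo_lie, coo_e) //= J1 J2 => <-; ring.
have J5 : coo (J (e F 6)) 5 = 0.
  have := congr1 (fun x => coo x 6) (h (e F 1)).
  rewrite !(cooE, coo_lie, coo_e) //= J1 J2 => h0.
  by apply: oppr_inj; rewrite oppr0 -h0; ring.
have JE : J (e F 6) = coo (J (e F 6)) 3 *: e F 3 + coo (J (e F 6)) 6 *: e F 6.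
  apply: coo_inj6; split;
    by rewrite cooD !cooZ !coo_e //= ?(J1, J2, J4, J5); ring.
exists (coo (J (e F 6)) 3); last by exists (coo (J (e F 6)) 6).
(* Otherwise e_6 is an eigenvector of J, with eigenvalue b satisfying b^2 = -1. *)
apply/eqP => a0; move: JE; rewrite a0 scale0r add0r; set b := coo _ _ => JE.
have := congr1 (fun x => coo x 6) (JK (e F 6)).
rewrite JE linearZ /= JE !(cooE, coo_e) //= mulr1 => /eqP.
by rewrite (negPf (sqr_neqN1 b)).
Qed.

End AbelianComplexStructure.

(** * Consequences of closedness *)

Section ClosedForm.
Variable w : {skew_symmetric (Th1 F)}.
Hypothesis closed_w :
  forall x y z, w (lie x y) z + w (lie y z) x + w (lie z x) y = 0.

Let lie12 : lie (e F 1) (e F 2) = e F 3.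
Proof. by_coo. Qed.

Let lie15 : lie (e F 1) (e F 5) = e F 6.
Proof. by_coo. Qed.

Let lie42 : lie (e F 4) (e F 2) = e F 6.
Proof. by_coo. Qed.

(** Closedness on e_1, e_5, x reduces the claim to x = e_5; there e_6 = [e_4, e_2], and e_5 commutes
    with both e_4 and e_2. *)
Lemma closed_e6W x : inW x -> w (e F 6) x = 0.
Proof.
move=> [x1 x2].
have w65 : w (e F 6) (e F 5) = 0.
  have := closed_w (e F 4) (e F 2) (e F 5); rewrite lie42.
  have -> : lie (e F 2) (e F 5) = 0 by by_coo.
  have -> : lie (e F 5) (e F 4) = 0 by by_coo.
  by rewrite !linear0l !addr0.
have := closed_w (e F 1) (e F 5) x; rewrite lie15.
have -> : lie (e F 5) x = 0.
  by apply: coo_inj6; split;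
    rewrite !(cooE, coo_lie, coo_e) //= ?(x1, x2); ring.
have -> : lie x (e F 1) = (- coo x 5) *: e F 6.
  by apply: coo_inj6; split;
    rewrite !(cooE, coo_lie, coo_e) //= ?(x1, x2); ring.
by rewrite linear0l linearZl_LR /= w65 mulr0 !addr0.
Qed.

Lemma closed_e61 : w (e F 6) (e F 1) = w (e F 3) (e F 4).
Proof.
have := closed_w (e F 1) (e F 2) (e F 4); rewrite lie12.
have -> : lie (e F 2) (e F 4) = - e F 6 by by_coo.
have -> : lie (e F 4) (e F 1) = 0 by by_coo.
by rewrite linear0l linearNl /= addr0 => /eqP; rewrite subr_eq0 => /eqP.
Qed.

Lemma closed_e62 : w (e F 6) (e F 2) = w (e F 3) (e F 5).
Proof.
have := closed_w (e F 1) (e F 2) (e F 5); rewrite lie12.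
have -> : lie (e F 2) (e F 5) = 0 by by_coo.
have -> : lie (e F 5) (e F 1) = - e F 6 by by_coo.
by rewrite linear0l linearNl /= addr0 => /eqP; rewrite subr_eq0 => /eqP.
Qed.

End ClosedForm.

Lemma abelian_not_kahler (J : {linear Th1 F -> Th1 F})
    (w : {skew_symmetric (Th1 F)}) :
  abelian_complex_structure J -> ~ kahler_structure J w.
Proof.
move=> abJ [[JK _] [nd closed_w] compat].
have e6W := closed_e6W closed_w.
have [a a0 [b JE]] := abelian_Je6 abJ.
have e3W x : inW x -> w (e F 3) x = 0.
  move=> Wx; apply: (mulfI a0); rewrite mulr0.
  have <- : w (J (e F 6)) x = 0.
    (* Writing - x as J (J x) lets compatibility remove one J from each argument, leaving w(e_6, J
       x) with J x in W. *)
    apply: oppr_inj; rewrite oppr0 -linearNr -JK.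
    apply: etrans (compat _ _) _; exact/e6W/abelian_inW.
  by rewrite JE linearDl !linearZl_LR /= (e6W x Wx) mulr0 addr0.
have e6_rad (y : Th1 F) : w (e F 6) y = 0.
  (* Splits y as v plus an element of W. *)
  pose v : Th1 F := coo y 1 *: e F 1 + coo y 2 *: e F 2.
  have wv : w (e F 6) v = 0.
    rewrite linearDr !linearZr_LR /= closed_e61 // closed_e62 //.
    by rewrite !e3W ?mulr0 ?addr0 //; split; rewrite coo_e.
  have wyv : w (e F 6) (y - v) = 0.
    by apply: e6W; split; rewrite !(cooE, coo_e) //=; ring.
  by move: wyv; rewrite linearBr /= wv subr0.
have /eqP := congr1 (fun x => coo x 6) (nondegenerateP _ nd _ e6_rad).
by rewrite coo_e // coo0 oner_eq0.
Qed.

End Abelian.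

Theorem lemma5p11 (R : realType) :
  (exists (J1 J2 : {linear Th1 R -> Th1 R})
          (w1 w2 : {skew_symmetric (Th1 R)}),
     [/\ kahler_structure J1 w1, kahler_structure J2 w2 &
         ~ (J1 =1 J2 /\ w1 =2 w2)]) /\
  (forall J : {linear Th1 R -> Th1 R},
     abelian_complex_structure J ->
     ~ exists w : {skew_symmetric (Th1 R)}, kahler_structure J w).
Proof.
have two_neq0 : (2 : R) != 0 by rewrite pnatr_eq0.
split.
  (* The same J serves twice; the two forms differ by 2 on e_2, e_5. *)
  exists (Jex (F := R)), (Jex (F := R)), (wex 1), (wex (-1)).
  split; [exact: Jex_wex_kahler (oner_neq0 R) | |].
    by apply: Jex_wex_kahler; rewrite ?oppr_eq0 ?oner_eq0.
  move=> [_ /(_ (e R 2) (e R 5))]; rewrite /= /wex !plE !coo_e //= => /eqP.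
  rewrite -subr_eq0; apply/negP.
  by rewrite (_ : _ - _ = 2) //; ring.
move=> J abJ [w]; apply: abelian_not_kahler abJ => b.
by apply/eqP => /esym bN1; have := sqr_ge0 b; rewrite expr2 -bN1 ler0N1.
Qed.
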